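(* Consider the halfspace-chasing algorithm with parameter $\epsilon\in(0,1]$ described in the context. Its total upward recourse $\sum_{t=1}^T\sum_{i=1}^n w_i(x_i^t-x_i^{t-1})_+$ is at most $O\!\left(\frac{1}{\epsilon}\log\frac{d\Delta}{\epsilon}\right)$ times the optimal value of the linear program $(\overline{\mathcal D})$.
   Context: Variables $x\in\mathbb{R}^n_+$, weights $w\in\mathbb{R}^n_{+}$. At times $t=1,\dots,T$ a single constraint arrives: for $t\in C$ a covering constraint $\langle c^t,x\rangle\ge 1$, for $t\in P$ a packing constraint $\langle p^t,x\rangle\le 1$, with $c^t,p^t\in\mathbb{R}^n_{\ge0}$ ($C\cup P=\{1,\dots,T\}$ disjoint). Let $d^t=|\{i:c_i^t\neq 0\}|$, $d=\max_t d^t$, $c_i^{\max}=\max_t c_i^t$, $c_i^{\min}=\min_{t:c_i^t\ne0}c_i^t$, $\Delta=\max_i c_i^{\max}/c_i^{\min}$. Write $a_+=\max(0,a)$. Algorithm (parameter $\epsilon$): $x^0=0$. It is assumed each arriving constraint is violated by $x^{t-1}$ (for packing: $\langle p^t,x^{t-1}\rangle>1+\epsilon$). For $t\in C$, coordinates with $c_i^t=0$ are unchanged, and the others are set to the minimizer of $\sum_{i:c_i^t\ne0} w_i[\hat x_i\log(\hat x_i/\hat x_i^{t-1})-\hat x_i]$ subject to $\langle c^t,x\rangle\ge1$, where $\hat x_i=x_i+\frac{\epsilon}{4d^tc_i^t}$ and $\hat x_i^{t-1}=x_i^{t-1}+\frac{\epsilon}{4d^tc_i^t}$. For $t\in P$,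 coordinates with $p_i^t=0$ are unchanged, and the others are set to the minimizer of $\sum_{i:p_i^t\ne0}w_i(x_i\log(x_i/x_i^{t-1})-x_i)$ subject to $\langle p^t,x\rangle\le 1+\epsilon$. The linear program $(\overline{\mathcal D})$: maximize $\sum_{t\in C}\bar y^t-\sum_{t\in P}\bar z^t$ over $\bar y^t,\bar z^t\ge0$ and $\bar r_i^t$ ($t=1,\dots,T+1$) subject to $c_i^t\bar y^t-\bar r_i^t+\bar r_i^{t+1}\le0$ for all $i$, $t\in C$; $-p_i^t\bar z^t-\bar r_i^t+\bar r_i^{t+1}\le 0$ for all $i$, $t\in P$; and $0\le \bar r_i^t\le w_i$. It is the LP dual of: minimize $\sum_t\sum_i w_i\bar\ell_i^t$ subject to $\langle c^t,\bar x^t\rangle\ge1$ ($t\in C$), $\langle p^t,\bar x^t\rangle\le1$ ($t\in P$), $\bar x_i^t-\bar x_i^{t-1}\le\bar\ell_i^t$, $\bar x,\bar\ell\ge0$ (the optimal offline upward recourse).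
   Formalization: The logarithm in the bound is read as max(1, log(dΔ/ε)): for d = Δ = ε = 1 the literal logarithm is 0 while the recourse can be positive; for dΔ/ε bounded away from 1 the bound is the literal one up to the constant. *)

(* Defs.v *)
From HB Require Import structures.
From mathcomp Require Import all_boot all_order all_algebra.
From mathcomp Require Import all_classical all_reals all_analysis.

Set Implicit Arguments.
Unset Strict Implicit.
Unset Printing Implicit Defensive.

Import Order.TTheory GRing.Theory Num.Theory.

Local Open Scope classical_set_scope.
Local Open Scope ring_scope.

(** Time indices.  The constraint arriving at time [t + 1] (for [t = 0 .. T-1])
    is indexed by [t : 'I_T].  Quantities living between two constraints are
    indexed by ['I_T.+1]: for the algorithm, [x k] is the point [x^k]; for the
    linear program, [r k] is the variable [\bar r^(k+1)].  In both cases the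
    constraint [t] relates the entries [before t] and [after t]. *)
Definition before T (t : 'I_T) : 'I_T.+1 := widen_ord (leqnSn T) t.
Definition after T (t : 'I_T) : 'I_T.+1 := lift ord0 t.

Definition dot (R : realType) n (u v : 'rV[R]_n) : R :=
  \sum_(i < n) u 0 i * v 0 i.

Definition nonneg (R : realType) n (u : 'rV[R]_n) : Prop :=
  forall i, 0 <= u 0 i.

Definition pos_part (R : realType) (a : R) : R := Num.max 0 a.

Definition is_argmin (R : realType) (X : Type) (A : set X) (f : X -> \bar R)
    (x : X) : Prop :=
  A x /\ forall y, A y -> (f x <= f y)%E.

(** [u log (u / v) - u] for [u, v >= 0], with the conventions
    [0 log (0 / v) = 0] (also for [v = 0]) and [u log (u / 0) = +oo] for
    [u > 0].  Since division by zero and [ln 0] are [0] in the library, the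
    second convention has to be made explicit; it is what keeps at [0] the
    coordinates that are [0] before a packing step. *)
Definition entropy (R : realType) (u v : R) : \bar R :=
  if u == 0 then 0%E
  else if v == 0 then +oo%E
  else (u * ln (u / v) - u)%:E.

Section Instance.
Context (R : realType) (n T : nat).
Variables (C : {set 'I_T}) (c : 'I_T -> 'rV[R]_n).

Definition row_sparsity (u : 'rV[R]_n) : nat := #|[pred i | u 0 i != 0]|.

Definition max_sparsity : nat := \max_(t in C) row_sparsity (c t).

Definition coef_max (i : 'I_n) : R := \big[Num.max/0]_(t in C) c t 0 i.

(** Starting the minimum from [coef_max i] is harmless when some [c_i^t] is
    nonzero; otherwise both extrema are [0], and so is their quotient, so that
    coordinates absent from all covering constraints do not count in
    [aspect_ratio]. *)
Definition coef_min (i : 'I_n) : R :=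
  \big[Num.min/coef_max i]_(t in C | c t 0 i != 0) c t 0 i.

Definition aspect_ratio : R :=
  \big[Num.max/0]_(i < n) (coef_max i / coef_min i).

End Instance.

Section Algorithm.
Context (R : realType) (n : nat).
Variables (eps : R) (w : 'rV[R]_n).

Definition shift (a : 'rV[R]_n) (i : 'I_n) : R :=
  eps / (4 * (row_sparsity a)%:R * a 0 i).

Definition covering_objective (a x' x : 'rV[R]_n) : \bar R :=
  (\sum_(i < n | a 0%R i != 0%R)
     (w 0 i)%R%:E * entropy (x 0 i + shift a i)%R (x' 0 i + shift a i)%R)%E.

Definition packing_objective (a x' x : 'rV[R]_n) : \bar R :=
  (\sum_(i < n | a 0%R i != 0%R)
     (w 0 i)%R%:E * entropy (x 0 i)%R (x' 0 i)%R)%E.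

(** Points of the nonnegative orthant that differ from [x'] only on the support
    of the arriving constraint [a]. *)
Definition reachable (a x' : 'rV[R]_n) : set 'rV[R]_n :=
  [set x | nonneg x /\ forall i, a 0 i = 0 -> x 0 i = x' 0 i].

Definition covering_step (a x' x : 'rV[R]_n) : Prop :=
  dot a x' < 1 /\
  is_argmin (reachable a x' `&` [set x | 1 <= dot a x])
    (covering_objective a x') x.

Definition packing_step (a x' x : 'rV[R]_n) : Prop :=
  1 + eps < dot a x' /\
  is_argmin (reachable a x' `&` [set x | dot a x <= 1 + eps])
    (packing_objective a x') x.

Definition is_run T (C : {set 'I_T}) (c p : 'I_T -> 'rV[R]_n)
    (x : 'I_T.+1 -> 'rV[R]_n) : Prop :=
  x ord0 = 0 /\
  forall t : 'I_T,
    if t \in C then covering_step (c t) (x (before t)) (x (after t))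
    else packing_step (p t) (x (before t)) (x (after t)).

Definition upward_recourse T (x : 'I_T.+1 -> 'rV[R]_n) : R :=
  \sum_(t < T) \sum_(i < n)
    w 0 i * pos_part (x (after t) 0 i - x (before t) 0 i).

End Algorithm.

Section DualProgram.
Context (R : realType) (n T : nat).
Variables (w : 'rV[R]_n) (C : {set 'I_T}) (c p : 'I_T -> 'rV[R]_n).

(** Only the [y t] with [t \in C] and the [z t] with [t \notin C] are variables
    of the program; the other entries occur neither in the remaining
    constraints nor in the objective. *)
Definition dual_feasible (y z : 'I_T -> R) (r : 'I_T.+1 -> 'rV[R]_n) : Prop :=
  [/\ forall t, 0 <= y t,
      forall t, 0 <= z t,
      forall t i, t \in C ->
        c t 0 i * y t - r (before t) 0 i + r (after t) 0 i <= 0,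
      forall t i, t \notin C ->
        - p t 0 i * z t - r (before t) 0 i + r (after t) 0 i <= 0
    & forall k i, 0 <= r k 0 i <= w 0 i].

Definition dual_objective (y z : 'I_T -> R) : R :=
  \sum_(t in C) y t - \sum_(t < T | t \notin C) z t.

Definition dual_opt : \bar R :=
  ereal_sup [set v | exists y z r,
    dual_feasible y z r /\ v = (dual_objective y z)%:E].

End DualProgram.

(** The quantity inside the [O(.)]: [1/eps * log (d * Delta / eps)].  As usual
    for such bounds, the logarithm is read as at least [1]: when
    [d = Delta = eps = 1] it vanishes, while the recourse does not. *)
Definition competitive_rate (R : realType) (eps : R) (d : nat) (Delta : R) : R :=
  eps^-1 * Num.max 1 (ln (d%:R * Delta / eps)).

(* Main.v *)
(** The optimality conditions of a step are purely multiplicative: on the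
    coordinates of positive weight, [x^_i = x^'_i exp (m a_i / w_i)] with [m = y]
    at a covering step and [m = - z], without shift, at a packing step: comparing
    the minimizer with the explicit point of this form leaves a nonpositive sum
    of divergences.  Hence
    [w_i (x_i - x'_i) <= m a_i x^_i], so a covering step moves by at most
    [(1 + eps/4) y] and a packing step decreases the weighted sum by at least
    [(1 + eps) z].  As the run starts at [0] and stays nonnegative,
    [(1 + eps) sum z <= (1 + eps/4) sum y]: the difference [sum y - sum z] is of
    order [eps sum y], while the recourse is at most [(1 + eps/4) sum y].
    The multipliers divided by [L] of order [log (d Delta / eps)] are feasible,
    with [r_i = (w_i / L) log (M_i / (x_i + delta_i))]: [delta_i] is a lower bound
    of the shifts of coordinate [i], and [M_i] an upper bound of
    [x_i + delta_i]. *)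

Require Import Defs.
From HB Require Import structures.
From mathcomp Require Import all_boot all_order all_algebra.
From mathcomp Require Import all_classical all_reals all_analysis.
From mathcomp Require Import ring lra.

Set Implicit Arguments.
Unset Strict Implicit.
Unset Printing Implicit Defensive.

Import Order.TTheory GRing.Theory Num.Theory.
Import numFieldNormedType.Exports.

Local Open Scope ring_scope.

(** * Entropy divergence: tangent bounds and multiplicative minimizers *)

(* The tangent inequality [u m - v e^m <= u log (u / v) - u] is the
   nonnegativity of the divergence of [u] from [v e^m]. *)
Lemma entropy_gt_tangent (R : realType) (u v m : R) :
  0 <= u -> 0 <= v -> u != v * expR m ->
  ((u * m - v * expR m)%:E < entropy u v)%E.
Proof.
move=> u0 v0 une; rewrite /entropy.
have [uE|un0] := eqVneq u 0.
  rewrite lte_fin uE mul0r sub0r oppr_lt0 lt_neqAle eq_sym.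
  by rewrite -uE eq_sym une uE mulr_ge0 // expR_ge0.
have [vE|vn0] := eqVneq v 0; first by rewrite ltry.
rewrite lte_fin.
have up : 0 < u by rewrite lt_neqAle eq_sym un0.
have vp : 0 < v by rewrite lt_neqAle eq_sym vn0.
set k := m - ln (u / v).
have vE : v * expR m = u * expR k.
  rewrite expRB lnK ?posrE ?divr_gt0 //; field.
  by rewrite un0 vn0.
have k0 : k != 0.
  by apply: contraNneq une => k0; rewrite vE k0 expR0 mulr1.
have ltk := expR_gt1Dx k0; rewrite -(ltr_pM2l up) in ltk.
rewrite vE; have -> : m = k + ln (u / v) by rewrite /k subrK.
lra.
Qed.

Lemma entropy_expR (R : realType) (v m : R) : 0 <= v ->
  entropy (v * expR m) v = (v * expR m * m - v * expR m)%:E.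
Proof.
move=> v0; rewrite /entropy mulf_eq0 (gt_eqF (expR_gt0 m)) orbF.
have [->|vn0] := eqVneq v 0; first by rewrite !mul0r subr0.
by rewrite [X in X / v]mulrC mulfK // expRK.
Qed.

Lemma entropy_ge_tangent (R : realType) (u v m : R) :
  0 <= u -> 0 <= v -> ((u * m - v * expR m)%:E <= entropy u v)%E.
Proof.
move=> u0 v0; have [->|une] := eqVneq u (v * expR m).
  by rewrite entropy_expR.
exact/ltW/entropy_gt_tangent.
Qed.

(* The comparison point [us] has the form dictated by stationarity for the
   multiplier [m]; coordinates of zero weight do not enter the objective and
   are left undetermined. *)
Lemma entropy_projection (R : realType) (n : nat) (S : pred 'I_n)
    (w a u us v : 'I_n -> R) (m : R) :
  (forall i, 0 <= w i) ->
  (forall i, S i -> 0 <= u i) -> (forall i, S i -> 0 <= v i) ->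
  (forall i, S i -> 0 < w i -> us i = v i * expR (m * a i / w i)) ->
  (\sum_(i | S i) (w i)%:E * entropy (u i) (v i)
     <= \sum_(i | S i) (w i)%:E * entropy (us i) (v i))%E ->
  m * (\sum_(i | S i && (0 < w i)) a i * us i)
    <= m * (\sum_(i | S i && (0 < w i)) a i * u i) ->
  forall i, S i -> 0 < w i -> u i = us i.
Proof.
move=> w0 u0 v0 usE le_obj le_dot.
(* Zero-weight terms vanish even where [entropy] is [+oo], since [0 * +oo = 0]. *)
have restr (g : 'I_n -> R) : (\sum_(i | S i) (w i)%:E * entropy (g i) (v i) =
    \sum_(i | S i && (0 < w i)%R) (w i)%:E * entropy (g i) (v i))%E.
  rewrite big_mkcondr; apply: eq_bigr => i _.
  case: ltP => // wle.
  by have -> : w i = 0; [apply/le_anti; rewrite wle w0 | rewrite mul0e].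
rewrite !restr in le_obj.
have usS : (\sum_(i | S i && (0 < w i)%R) (w i)%:E * entropy (us i) (v i) =
    (\sum_(i | S i && (0 < w i)) (m * (a i * us i) - w i * us i))%R%:E)%E.
  rewrite -sumEFin; apply: eq_bigr => i /andP[Si wi].
  rewrite usE // entropy_expR ?v0 // -EFinM; congr (_%:E).
  by field; rewrite gt_eqF.
have tangentE i g : 0 < w i -> S i ->
    w i * (g * (m * a i / w i) - v i * expR (m * a i / w i)) =
    m * (a i * g) - w i * us i.
  by move=> wi Si; rewrite usE //; field; rewrite gt_eqF.
have le_sums : \sum_(i | S i && (0 < w i)) (m * (a i * us i) - w i * us i) <=
    \sum_(i | S i && (0 < w i)) (m * (a i * u i) - w i * us i).
  by rewrite !sumrB lerD2r -!mulr_sumr.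
(* One coordinate off [us] would make the summed tangent bound strict, so the objective at [u] would
   exceed the one at [us]. *)
move=> k Sk wk; apply/eqP/negPn/negP => neq.
have: ((\sum_(i | S i && (0 < w i)) (m * (a i * u i) - w i * us i))%R%:E <
    \sum_(i | S i && (0 < w i)%R) (w i)%:E * entropy (u i) (v i))%E.
  rewrite -sumEFin (bigD1 k) ?Sk //= [ltRHS](bigD1 k) ?Sk //=.
  apply: lte_leD; first by rewrite sumEFin.
  - rewrite -tangentE // EFinM lte_pmul2l //.
    by apply: entropy_gt_tangent; rewrite ?u0 ?v0 // -usE.
  - apply: lee_sum => i /andP[/andP[Si wi] _].
    rewrite -tangentE // EFinM lee_pmul2l //.
    by apply: entropy_ge_tangent; rewrite ?u0 ?v0.
rewrite ltNge => /negP; apply; apply: le_trans le_obj _.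
by rewrite usS lee_fin.
Qed.

(** The intermediate value theorem for [phi]; it calibrates the multiplier so that the comparison
    point makes its constraint tight. *)
Lemma exists_multiplier (R : realType) (n : nat) (P : pred 'I_n)
    (a w v : 'I_n -> R) (m1 m2 b : R) :
  let phi m := \sum_(i | P i) a i * (v i * expR (m * a i / w i)) in
  m1 <= m2 -> phi m1 <= b <= phi m2 ->
  exists2 m, m1 <= m <= m2 & phi m = b.
Proof.
move=> phi le12 /andP[le1 le2].
have cphi : continuous phi.
  apply: continuous_big => [|i _ m]; first exact: add_continuous.
  apply: cvgMl_tmp; apply: cvgMl_tmp.
  apply: continuous_comp; last exact: continuous_expR.
  by apply: cvgMr_tmp; apply: cvgMr_tmp; exact: cvg_id.
have [|m mI mE] := @IVT R phi m1 m2 b le12 (continuous_subspaceT cphi).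
  by rewrite ge_min le1 le_max le2 orbT.
by exists m => //; rewrite in_itv in mI.
Qed.

(** With [k = m * a / w], one has [v = u * expR (- k) >= u * (1 - k)]. The bound involves the new
    value [u], since a tight constraint controls the sum of the [a * u]. *)
Lemma weighted_move_le (R : realType) (w a u v m : R) :
  0 < w -> 0 <= v -> u = v * expR (m * a / w) -> w * (u - v) <= m * (a * u).
Proof.
move=> w0 v0 uE; set k := m * a / w in uE.
have kE : m * a = w * k by rewrite /k; field; rewrite gt_eqF.
have vE : v = u * expR (- k) by rewrite uE -mulrA -expRD subrr expR0 mulr1.
have u0 : 0 <= u by rewrite uE mulr_ge0 // expR_ge0.
rewrite mulrA kE -mulrA ler_pM2l // {1}vE.
have := ler_wpM2l u0 (expR_ge1Dx (- k)); lra.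
Qed.

(** * Lagrange multipliers of a single step *)

Lemma dot_support (R : realType) (n : nat) (a x : 'rV[R]_n) :
  dot a x = \sum_(i | a 0 i != 0) a 0 i * x 0 i.
Proof.
rewrite /dot [RHS]big_mkcond; apply: eq_bigr => i _.
by case: eqVneq => // ->; rewrite mul0r.
Qed.

(** An explicit feasible point of multiplicative form is built first; [entropy_projection] then
    identifies the minimizer with it on positive weights. The last clause is complementary
    slackness. *)
Lemma covering_step_multiplier (R : realType) (n : nat) (eps : R)
    (w a x' x : 'rV[R]_n) :
  0 < eps -> nonneg w -> nonneg a -> nonneg x' ->
  covering_step eps w a x' x ->
  exists y, [/\ 0 <= y,
    forall i, a 0 i != 0 -> 0 < w 0 i ->
      x 0 i + Defs.shift eps a i =
        (x' 0 i + Defs.shift eps a i) * expR (y * a 0 i / w 0 i)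
    & 0 < y -> dot a x = 1 /\ forall i, a 0 i != 0 -> 0 < w 0 i].
Proof.
move=> eps0 w0 a0 x'0 [viol [[[x0 xE] cov] xmin]].
rewrite /= in x0 xE cov.
have ap i : a 0 i != 0 -> 0 < a 0 i by move=> ai; rewrite lt_neqAle eq_sym ai a0.
have shp i : a 0 i != 0 -> 0 < Defs.shift eps a i.
  move=> ai; rewrite /Defs.shift divr_gt0 // mulr_gt0 ?ap // mulr_gt0 // ltr0n.
  by apply/card_gt0P; exists i.
have [i1 ai1] : exists i, a 0 i != 0.
  apply/existsP; apply: contraT => /existsPn H.
  move: cov; rewrite dot_support big_pred0; first by rewrite ler10.
  by move=> i; apply/negbTE/H.
have proj := entropy_projection (S := fun i => a 0 i != 0) (w := w 0) (a := a 0)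
  (u := fun i => x 0 i + Defs.shift eps a i) (v := fun i => x' 0 i + Defs.shift eps a i).
have uh0 i : a 0 i != 0 -> 0 <= x 0 i + Defs.shift eps a i.
  by move=> ai; rewrite addr_ge0 // ltW // shp.
have vh0 i : a 0 i != 0 -> 0 <= x' 0 i + Defs.shift eps a i.
  by move=> ai; rewrite addr_ge0 // ltW // shp.
(* Raising a zero-weight coordinate by [(a 0 i)^-1] meets the constraint at no cost, so the
   multiplier is [0]. *)
have [i0 /andP[ai0 /eqP wi0]|wpos] := pickP (fun i => (a 0 i != 0) && (w 0 i == 0)).
  exists 0; split=> // [i ai wi|]; last by rewrite ltxx.
  pose xs : 'rV[R]_n := \row_i (if i == i0 then x' 0 i + (a 0 i)^-1 else x' 0 i).
  rewrite !mul0r expR0 mulr1.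
  have -> : x' 0 i + Defs.shift eps a i = xs 0 i + Defs.shift eps a i.
    by rewrite mxE; case: eqP => // ii0; rewrite ii0 wi0 ltxx in wi.
  apply: (proj (fun i => xs 0 i + Defs.shift eps a i) 0) => //.
  - move=> j aj wj; rewrite !mul0r expR0 mulr1 mxE.
    by case: eqP => // ji0; rewrite ji0 wi0 ltxx in wj.
  - apply: xmin; split; first split=> j.
    + by rewrite mxE; case: ifP => // _; rewrite addr_ge0 ?invr_ge0.
    + by move=> aj; rewrite mxE; case: eqP => // ji0; rewrite -ji0 aj eqxx in ai0.
    rewrite /= /dot (bigD1 i0) //= mxE eqxx mulrDr divff //.
    rewrite -addrA addrCA lerDl addr_ge0 ?mulr_ge0 // sumr_ge0 // => j ji0.
    by rewrite mxE (negbTE ji0) mulr_ge0.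
  - by rewrite !mul0r.
have wp i : a 0 i != 0 -> 0 < w 0 i.
  move=> ai; rewrite lt_neqAle w0 andbT eq_sym; apply/negP => wi.
  by move: (wpos i); rewrite ai wi.
(* The right-hand side of the covering constraint in shifted coordinates. *)
pose b := 1 + \sum_(i | a 0 i != 0) a 0 i * Defs.shift eps a i.
have b0 : 0 < b.
  by rewrite ltr_pwDl // sumr_ge0 // => i ai; rewrite mulr_ge0 // ltW // shp.
(* [M] is chosen so that the single term [i1], bounded below through [expR k >= k], already reaches
   [b]. *)
pose M := b * w 0 i1 / (a 0 i1 ^+ 2 * (x' 0 i1 + Defs.shift eps a i1)).
have v1 : 0 < x' 0 i1 + Defs.shift eps a i1 by rewrite ltr_wpDl // shp.
have M0 : 0 <= M.
  rewrite divr_ge0 ?mulr_ge0 ?exprn_ge0 //; [exact: ltW | exact: ltW].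
have [||y /andP[y0 _] yE] := exists_multiplier (P := fun i => a 0 i != 0)
    (a := a 0) (w := w 0) (v := fun i => x' 0 i + Defs.shift eps a i)
    (b := b) (m1 := 0) (m2 := M).
- exact: M0.
- apply/andP; split.
    under eq_bigr => i ai do rewrite !mul0r expR0 mulr1 mulrDr.
    by rewrite big_split /= lerD2r -dot_support ltW.
  rewrite (bigD1 i1) //=.
  apply: ler_wpDr.
    by apply: sumr_ge0 => i /andP[ai _]; rewrite !mulr_ge0 ?expR_ge0 ?vh0.
  have := expR_ge1Dx (M * a 0 i1 / w 0 i1).
  set e := expR _ => le_e.
  have av : 0 < a 0 i1 * (x' 0 i1 + Defs.shift eps a i1) by rewrite mulr_gt0 ?ap.
  rewrite mulrA.
  apply: (@le_trans _ _ (a 0 i1 * (x' 0 i1 + Defs.shift eps a i1) *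
      (M * a 0 i1 / w 0 i1))).
    rewrite le_eqVlt; apply/orP; left; apply/eqP; rewrite /M; field.
    by rewrite ai1 !gt_eqF // wp.
  by rewrite ler_pM2l //; apply: le_trans le_e; rewrite lerDr.
pose xs : 'rV[R]_n := \row_i (if a 0 i == 0 then x' 0 i else
  (x' 0 i + Defs.shift eps a i) * expR (y * a 0 i / w 0 i) - Defs.shift eps a i).
have xsE i : a 0 i != 0 -> xs 0 i + Defs.shift eps a i =
    (x' 0 i + Defs.shift eps a i) * expR (y * a 0 i / w 0 i).
  by move=> ai; rewrite mxE (negbTE ai) subrK.
have hatE (z : 'rV[R]_n) : \sum_(i | a 0 i != 0) a 0 i * (z 0 i + Defs.shift eps a i) =
    dot a z + (b - 1).
  under eq_bigr => i ai do rewrite mulrDr.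
  by rewrite big_split /= -dot_support /b; lra.
have dxs : dot a xs = 1.
  have := hatE xs.
  rewrite (eq_bigr (fun i => a 0 i * ((x' 0 i + Defs.shift eps a i) *
    expR (y * a 0 i / w 0 i)))); last by move=> i ai; rewrite xsE.
  by rewrite yE; lra.
have restr (F : 'I_n -> R) : \sum_(i | (a 0 i != 0) && (0 < w 0 i)) F i =
    \sum_(i | a 0 i != 0) F i.
  by apply: eq_bigl => i; case: (boolP (a 0 i != 0)) => //= /wp ->.
have eqx i : a 0 i != 0 -> x 0 i + Defs.shift eps a i = xs 0 i + Defs.shift eps a i.
  move=> ai.
  apply: (proj (fun i => xs 0 i + Defs.shift eps a i) y) => //; last exact: wp.
  - by move=> j aj _; exact: xsE.
  - apply: xmin; split; last by rewrite /= dxs.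
    split=> j; last by move=> aj; rewrite mxE aj eqxx.
    rewrite mxE; case: (eqVneq (a 0 j) 0) => [_|aj]; first exact: x'0.
    rewrite subr_ge0; apply: (@le_trans _ _ (x' 0 j + Defs.shift eps a j)).
      by rewrite lerDr.
    rewrite ler_peMr ?vh0 //.
    by rewrite -expR0 ler_expR !mulr_ge0 ?invr_ge0.
  - by rewrite !restr !hatE dxs ler_wpM2l // lerD2r.
exists y; split=> // [i ai _|_]; first by rewrite eqx // xsE.
split=> //; rewrite -dxs !dot_support; apply: eq_bigr => i ai.
by congr (_ * _); apply: (addIr (Defs.shift eps a i)); exact: eqx.
Qed.

(** Same method with multiplier [- z]. Slackness is stated on positive weights because the
    comparison point is [0] on the other coordinates of the support. *)
Lemma packing_step_multiplier (R : realType) (n : nat) (eps : R)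
    (w a x' x : 'rV[R]_n) :
  0 < eps -> nonneg w -> nonneg a -> nonneg x' ->
  packing_step eps w a x' x ->
  exists z, [/\ 0 <= z,
    forall i, a 0 i != 0 -> 0 < w 0 i ->
      x 0 i = x' 0 i * expR (- z * a 0 i / w 0 i)
    & 0 < z ->
      \sum_(i | (a 0 i != 0) && (0 < w 0 i)) a 0 i * x 0 i = 1 + eps].
Proof.
move=> eps0 w0 a0 x'0 [viol [[[x0 xE] pack] xmin]].
rewrite /= in x0 xE pack.
have dotE (z : 'rV[R]_n) : nonneg z ->
    \sum_(i | (a 0 i != 0) && (0 < w 0 i)) a 0 i * z 0 i <= dot a z.
  move=> z0; rewrite dot_support big_mkcondr; apply: ler_sum => i ai.
  by case: ifP => // _; rewrite mulr_ge0.
(* Setting zero-weight coordinates to [0] is free and only helps a packing constraint. *)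
pose xs z : 'rV[R]_n := \row_i (if a 0 i == 0 then x' 0 i else
  if 0 < w 0 i then x' 0 i * expR (- z * a 0 i / w 0 i) else 0).
have xsE z i : a 0 i != 0 -> 0 < w 0 i ->
    xs z 0 i = x' 0 i * expR (- z * a 0 i / w 0 i).
  by move=> ai wi; rewrite mxE (negbTE ai) wi.
have dxs z : dot a (xs z) = \sum_(i | (a 0 i != 0) && (0 < w 0 i))
    a 0 i * (x' 0 i * expR (- z * a 0 i / w 0 i)).
  rewrite dot_support [RHS]big_mkcondr; apply: eq_bigr => i ai.
  by rewrite mxE (negbTE ai); case: ifP => // _; rewrite mulr0.
(* For [z > 0], tightness bounds the minimizer's dot product by that of [xs z]; the sign of [- z]
   turns this into the inequality required by [entropy_projection]. *)
have key z : 0 <= z -> dot a (xs z) <= 1 + eps ->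
    (0 < z -> dot a (xs z) = 1 + eps) ->
    forall i, a 0 i != 0 -> 0 < w 0 i -> x 0 i = xs z 0 i.
  move=> z0 feas tight.
  apply: (entropy_projection (w := w 0) (a := a 0) (v := x' 0) (m := - z)) => //.
  - by move=> i ai wi; rewrite xsE.
  - apply: xmin; split; last exact: feas.
    split=> i; last by move=> ai; rewrite mxE ai eqxx.
    rewrite mxE; case: ifP => // _; case: ifP => // _.
    by rewrite mulr_ge0 ?expR_ge0.
  - have [zp|zn] := ltP 0 z; last first.
      by have -> : z = 0; [lra | rewrite oppr0 !mul0r].
    rewrite !mulNr lerN2 ler_pM2l //.
    apply: le_trans (dotE _ x0) (le_trans pack _).
    rewrite -(tight zp) dxs le_eqVlt; apply/orP; left; apply/eqP.
    by apply: eq_bigr => i /andP[ai wi]; rewrite xsE.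
(* If clearing the zero-weight coordinates already restores feasibility, the multiplier is [0]. *)
have [le0|gt0] := leP (dot a (xs 0)) (1 + eps).
  exists 0; split=> //; last by rewrite ltxx.
  by move=> i ai wi; rewrite (key 0) // ?xsE // ltxx.
(* With [k = M * a / w], [expR k >= k] gives [a * expR (- k) <= w / M]; hence the sum at [- M] is at
   most [1]. *)
pose M := 1 + \sum_(i | (a 0 i != 0) && (0 < w 0 i)) x' 0 i * w 0 i.
have M0 : 0 < M by rewrite ltr_pwDl // sumr_ge0 // => i _; rewrite mulr_ge0.
have [||m /andP[_ m0] mE] := exists_multiplier
    (P := fun i => (a 0 i != 0) && (0 < w 0 i)) (a := a 0) (w := w 0) (v := x' 0)
    (b := 1 + eps) (m1 := - M) (m2 := 0).
- by rewrite oppr_le0 ltW.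
- apply/andP; split; last by have := ltW gt0; rewrite dxs oppr0.
  apply: (@le_trans _ _ 1); last by rewrite lerDl ltW.
  apply: (@le_trans _ _ (\sum_(i | (a 0 i != 0) && (0 < w 0 i)) x' 0 i * w 0 i / M)).
    apply: ler_sum => i /andP[ai wi].
    have ap : 0 < a 0 i by rewrite lt_neqAle eq_sym ai a0.
    have k0 : 0 < M * a 0 i / w 0 i by rewrite divr_gt0 ?mulr_gt0.
    rewrite !mulNr expRN.
    have le_e : M * a 0 i / w 0 i <= expR (M * a 0 i / w 0 i).
      by apply: le_trans (expR_ge1Dx _); rewrite lerDr.
    rewrite mulrCA -[leRHS]mulrA ler_wpM2l //.
    have -> : w 0 i / M = a 0 i * (M * a 0 i / w 0 i)^-1.
      by field; rewrite ai !gt_eqF.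
    by rewrite ler_pM2l // lef_pV2 // posrE ?expR_gt0.
  rewrite -mulr_suml ler_pdivrMr // mul1r /M.
  by rewrite lerDr.
have mE' : dot a (xs (- m)) = 1 + eps by rewrite dxs opprK.
exists (- m); split; first by rewrite oppr_ge0.
  by move=> i ai wi; rewrite (key (- m)) ?xsE ?oppr_ge0 // mE'.
move=> _; rewrite -mE' dxs; apply: eq_bigr => i /andP[ai wi].
by rewrite (key (- m)) ?xsE ?oppr_ge0 // mE'.
Qed.

(** * What each step contributes to the dual solution *)

(* A coordinate of zero weight is not determined by the step, so nothing is
   claimed about it; in a covering constraint it forces [y = 0]. *)
Definition covering_multiplier (R : realType) (n : nat) (eps : R)
    (w a x' x : 'rV[R]_n) (y : R) : Prop :=
  [/\ 0 <= y,
    0 < y -> forall i, a 0 i != 0 -> 0 < w 0 i,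
    forall i, 0 < w 0 i -> x' 0 i <= x 0 i /\
      (x 0 i <= x' 0 i \/ a 0 i != 0 /\ a 0 i * x 0 i <= 1),
    forall i delta, 0 < w 0 i -> (a 0 i != 0 -> delta <= Defs.shift eps a i) ->
      (x' 0 i + delta) * expR (y * a 0 i / w 0 i) <= x 0 i + delta
    & \sum_i w 0 i * (x 0 i - x' 0 i) <= (1 + eps / 4) * y].

(** [delta] stays free because one value per coordinate must serve all steps of the run. A packing
    step contracts, so adding [delta >= 0] only weakens the contraction. *)
Definition packing_multiplier (R : realType) (n : nat) (eps : R)
    (w a x' x : 'rV[R]_n) (z : R) : Prop :=
  [/\ 0 <= z,
    forall i, 0 < w 0 i -> x 0 i <= x' 0 i,
    forall i delta, 0 < w 0 i -> 0 <= delta ->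
      (x' 0 i + delta) * expR (- z * a 0 i / w 0 i) <= x 0 i + delta
    & \sum_i w 0 i * (x 0 i - x' 0 i) <= - ((1 + eps) * z)].

Lemma covering_step_dual (R : realType) (n : nat) (eps : R)
    (w a x' x : 'rV[R]_n) :
  0 < eps -> nonneg w -> nonneg a -> nonneg x' ->
  covering_step eps w a x' x ->
  exists y, covering_multiplier eps w a x' x y.
Proof.
move=> eps0 w0 a0 x'0 step.
have [y [y0 xhE tight]] := covering_step_multiplier eps0 w0 a0 x'0 step.
case: step => _ [[[x0 xE] _] _]; rewrite /= in x0 xE.
have sh0 i : 0 <= Defs.shift eps a i.
  by rewrite /Defs.shift divr_ge0 ?mulr_ge0 ?ler0n // ltW.
have e1 i : 1 <= expR (y * a 0 i / w 0 i).
  by rewrite -expR0 ler_expR !mulr_ge0 ?invr_ge0.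
have dshift i delta : 0 < w 0 i -> (a 0 i != 0 -> delta <= Defs.shift eps a i) ->
    (x' 0 i + delta) * expR (y * a 0 i / w 0 i) <= x 0 i + delta.
  move=> wi le_sh; have [ai|ai] := eqVneq (a 0 i) 0.
    by rewrite ai mulr0 mul0r expR0 mulr1 xE.
  have := xhE i ai wi; have := e1 i; have := le_sh ai.
  move: (expR _) (Defs.shift _ _ _) => e s les lee E.
  have -> : x 0 i = (x' 0 i + s) * e - s by rewrite -E addrK.
  (* Passing from the shift [s] to a smaller [delta] leaves the slack [(s - delta) * (e - 1)]. *)
  rewrite -subr_ge0.
  have -> : (x' 0 i + s) * e - s + delta - (x' 0 i + delta) * e =
    (s - delta) * (e - 1) by ring.
  by rewrite mulr_ge0 // subr_ge0.
exists y; split=> //.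
- by move=> /tight[].
- move=> i wi; split.
    have := @dshift i 0 wi (fun _ => sh0 i); rewrite !addr0; apply: le_trans.
    by rewrite ler_peMr.
  have [ai|ai] := eqVneq (a 0 i) 0; first by left; rewrite xE.
  have [yp|yn] := ltP 0 y.
    right; split=> //; rewrite -(tight yp).1 /dot (bigD1 i) //= lerDl.
    by apply: sumr_ge0 => j _; rewrite mulr_ge0.
  have y00 : y = 0 by lra.
  by left; have := xhE i ai wi; rewrite y00 !mul0r expR0 mulr1 => /addIr ->.
- have le_term i : w 0 i * (x 0 i - x' 0 i) <=
      if a 0 i != 0 then y * (a 0 i * (x 0 i + Defs.shift eps a i)) else 0.
    case: eqVneq => [ai|ai] /=; first by rewrite xE // subrr mulr0.
    have [wi|wi] := ltP 0 (w 0 i).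
      have -> : x 0 i - x' 0 i =
        (x 0 i + Defs.shift eps a i) - (x' 0 i + Defs.shift eps a i) by ring.
      by apply: weighted_move_le => //; [rewrite addr_ge0 | exact: xhE].
    have -> : w 0 i = 0 by apply/le_anti; rewrite wi w0.
    by rewrite mul0r !mulr_ge0 // addr_ge0.
  apply: le_trans (ler_sum _ (fun i _ => le_term i)) _.
  rewrite -big_mkcond -mulr_sumr mulrC.
  have [yp|yn] := ltP 0 y; last by have -> : y = 0; [lra | rewrite !mulr0].
  rewrite ler_wpM2r //.
  under eq_bigr => i ai do rewrite mulrDr.
  rewrite big_split /= -dot_support (tight yp).1 lerD2l.
  (* Each coordinate of the support contributes the same amount, so the shifts add [eps / 4] in
     total. *)
  rewrite (eq_bigr (fun=> eps / (4 * (row_sparsity a)%:R))); last first.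
    move=> i ai; rewrite /Defs.shift; field.
    rewrite ai pnatr_eq0 -lt0n.
    by apply/andP; split=> //; apply/card_gt0P; exists i.
  rewrite sumr_const -/(row_sparsity a).
  have [->|r0] := eqVneq (row_sparsity a) 0%N; first by rewrite mulr0n; lra.
  rewrite -mulr_natr le_eqVlt; apply/orP; left; apply/eqP; field.
  by rewrite pnatr_eq0.
Qed.

Lemma packing_step_dual (R : realType) (n : nat) (eps : R)
    (w a x' x : 'rV[R]_n) :
  0 < eps -> nonneg w -> nonneg a -> nonneg x' ->
  packing_step eps w a x' x ->
  exists z, packing_multiplier eps w a x' x z.
Proof.
move=> eps0 w0 a0 x'0 step.
have [z [z0 xmE tight]] := packing_step_multiplier eps0 w0 a0 x'0 step.
case: step => _ [[[x0 xE] _] _]; rewrite /= in x0 xE.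
have xmE' i : 0 < w 0 i -> x 0 i = x' 0 i * expR (- z * a 0 i / w 0 i).
  move=> wi; have [ai|ai] := eqVneq (a 0 i) 0; last exact: xmE.
  by rewrite ai mulr0 mul0r expR0 mulr1 xE.
have e1 i : expR (- z * a 0 i / w 0 i) <= 1.
  by rewrite -expR0 ler_expR !mulNr oppr_le0 !mulr_ge0 ?invr_ge0.
exists z; split=> //.
- by move=> i wi; rewrite xmE' // ler_piMr.
- by move=> i delta wi d0; rewrite mulrDl -xmE' // lerD2l ler_piMr.
- have le_term i : w 0 i * (x 0 i - x' 0 i) <=
      if (a 0 i != 0) && (0 < w 0 i) then - z * (a 0 i * x 0 i) else 0.
    have [wi|wi] := ltP 0 (w 0 i); last first.
      have -> : w 0 i = 0 by apply/le_anti; rewrite wi w0.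
      by rewrite mul0r andbF.
    case: eqVneq => [ai|ai] /=; first by rewrite xE // subrr mulr0.
    by apply: weighted_move_le => //; exact: xmE.
  apply: le_trans (ler_sum _ (fun i _ => le_term i)) _.
  rewrite -big_mkcond -mulr_sumr.
  have [zp|zn] := ltP 0 z; last first.
    by have -> : z = 0; [lra | rewrite oppr0 mulr0 mul0r oppr0].
  by rewrite tight // mulNr mulrC.
Qed.

(** * Induction and telescoping along a run *)

Lemma run_ind (T : nat) (P : 'I_T.+1 -> Prop) :
  P ord0 -> (forall t, P (before t) -> P (after t)) -> forall k, P k.
Proof.
move=> P0 PS [m]; elim: m => [|m IHm] ltm.
  by have -> : Ordinal ltm = ord0 by exact: val_inj.
have -> : Ordinal ltm = after (Ordinal (ltm : m < T)%N) by exact: val_inj.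
apply: PS.
have -> : before (Ordinal (ltm : m < T)%N) = Ordinal (ltnW ltm) by exact: val_inj.
exact: IHm.
Qed.

Lemma telescope_run (V : zmodType) (T : nat) (f : 'I_T.+1 -> V) :
  \sum_(t < T) (f (after t) - f (before t)) = f ord_max - f ord0.
Proof.
rewrite sumrB; apply/eqP; rewrite subr_eq addrAC eq_sym subr_eq addrC.
by rewrite -big_ord_recr addrC -big_ord_recl.
Qed.

(** * Extremal covering coefficients *)

Section Coefficients.
Context (R : realType) (n T : nat) (C : {set 'I_T}) (c : 'I_T -> 'rV[R]_n).

Lemma coef_max_ge t i : t \in C -> c t 0 i <= coef_max C c i.
Proof. by move=> tC; exact: (le_bigmax_cond 0 (fun t => c t 0 i)). Qed.

Lemma coef_min_le t i : t \in C -> c t 0 i != 0 -> coef_min C c i <= c t 0 i.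
Proof.
move=> tC ci.
by apply: (bigmin_le_cond (coef_max C c i) (fun t => c t 0 i)); rewrite tC.
Qed.

Lemma coef_min_gt0 i : (forall t, t \in C -> nonneg (c t)) ->
  0 < coef_max C c i -> 0 < coef_min C c i.
Proof.
move=> c0 cmax; apply: lt_bigmin => // t /andP[tC ci].
by rewrite lt_neqAle eq_sym ci c0.
Qed.

Lemma coef_min_le_max i : coef_min C c i <= coef_max C c i.
Proof. exact: bigmin_le_id. Qed.

Lemma row_sparsity_gt0 (u : 'rV[R]_n) i : u 0 i != 0 -> (0 < row_sparsity u)%N.
Proof. by move=> ui; apply/card_gt0P; exists i. Qed.

Lemma row_sparsity_le_max t :
  t \in C -> (row_sparsity (c t) <= max_sparsity C c)%N.
Proof. by move=> tC; apply: leq_bigmax_cond. Qed.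

Lemma max_sparsity_gt0 i : 0 < coef_max C c i -> (0 < max_sparsity C c)%N.
Proof.
move=> cmax; have /existsP[t /andP[tC ci]] : [exists t, (t \in C) && (c t 0 i != 0)].
  apply: contraT => /existsPn H; move: cmax; rewrite ltNge => /negP; case.
  apply: bigmax_le => // t tC.
  by move: (H t); rewrite tC /= negbK => /eqP ->.
exact: leq_trans (row_sparsity_gt0 ci) (row_sparsity_le_max tC).
Qed.

Lemma aspect_ratio_ge i : coef_max C c i / coef_min C c i <= aspect_ratio C c.
Proof. exact: (le_bigmax 0 (fun i => coef_max C c i / coef_min C c i)). Qed.

End Coefficients.

(** * The logarithmic potential behind the dual variables [r] *)

Section Potential.
Context (R : realType).

Definition potential (M delta w x : R) : R := w * ln (M / (x + delta)).

(** Logarithms turn multiplicative growth into an additive dual constraint. [k] stands for [m * c]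
    or [- m * p], and [M] cancels in the difference. *)
Lemma potential_drop (M delta w x' x k : R) :
  0 < M -> 0 < delta -> 0 < w -> 0 <= x' -> 0 <= x ->
  (x' + delta) * expR (k / w) <= x + delta ->
  k <= potential M delta w x' - potential M delta w x.
Proof.
move=> M0 d0 w0 x'0 x0 le_x; rewrite /potential -mulrBr.
have xd : 0 < x + delta by rewrite ltr_wpDl.
have xd' : 0 < x' + delta by rewrite ltr_wpDl.
rewrite !ln_div ?posrE // opprB addrC addrA subrK.
rewrite mulrC -ler_pdivrMr // lerBrDl.
by rewrite -ler_expR expRD !lnK ?posrE.
Qed.

(** The box constraint before division by [L]: [M] secures the lower bound, while [delta] keeps the
    logarithm bounded at [x = 0]. *)
Lemma potential_bounds (M delta w x L : R) :
  0 < delta -> 0 <= w -> 0 <= x -> x + delta <= M -> M / delta <= expR L ->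
  0 <= potential M delta w x <= w * L.
Proof.
move=> d0 w0 x0 leM leL; rewrite /potential.
have xd : 0 < x + delta by rewrite ltr_wpDl.
have M0 : 0 < M by exact: lt_le_trans leM.
apply/andP; split.
  by rewrite mulr_ge0 // ln_ge0 // ler_pdivlMr // mul1r.
rewrite ler_wpM2l // -ler_expR lnK ?posrE ?divr_gt0 //.
apply: le_trans leL; rewrite ler_pM2l // lef_pV2 ?posrE //.
by rewrite lerDr.
Qed.

End Potential.

(** * From single steps to the competitive bound *)

Lemma run_nonneg (R : realType) (n T : nat) (eps : R) (w : 'rV[R]_n)
    (C : {set 'I_T}) (c p : 'I_T -> 'rV[R]_n) (x : 'I_T.+1 -> 'rV[R]_n) :
  is_run eps w C c p x -> forall k, nonneg (x k).
Proof.
case=> x0 step; apply: run_ind => [i|t _]; first by rewrite x0 mxE.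
by have := step t; case: ifP => _ [_ [[[]]]].
Qed.

Lemma run_multipliers (R : realType) (n T : nat) (eps : R) (w : 'rV[R]_n)
    (C : {set 'I_T}) (c p : 'I_T -> 'rV[R]_n) (x : 'I_T.+1 -> 'rV[R]_n) :
  0 < eps -> nonneg w ->
  (forall t, t \in C -> nonneg (c t)) -> (forall t, t \notin C -> nonneg (p t)) ->
  is_run eps w C c p x ->
  exists m : 'I_T -> R, forall t,
    if t \in C then covering_multiplier eps w (c t) (x (before t)) (x (after t)) (m t)
    else packing_multiplier eps w (p t) (x (before t)) (x (after t)) (m t).
Proof.
move=> eps0 w0 c0 p0 run; have xk := run_nonneg run; case: run => _ step.
suff /choice[m mE] : forall t, exists y, if t \in C
    then covering_multiplier eps w (c t) (x (before t)) (x (after t)) y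
    else packing_multiplier eps w (p t) (x (before t)) (x (after t)) y.
  by exists m.
move=> t; have := step t; case: ifPn => tC.
  exact: covering_step_dual (c0 t tC) (xk _).
exact: packing_step_dual (p0 t tC) (xk _).
Qed.

Lemma rate_max_gt0 (R : realType) (u : R) : 0 < Num.max 1 u.
Proof. by rewrite lt_max ltr01. Qed.

(** [1 + 4 * D] will bound [M i / delta i]. It is at most [5 * D <= expR 4 * D], and the maximum
    with [1] absorbs the [4]. *)
Lemma ratio_le_expR (R : realType) (D : R) :
  1 <= D -> 1 + 4 * D <= expR (5 * Num.max 1 (ln D)).
Proof.
move=> D1; have D0 : 0 < D by exact: lt_le_trans D1.
apply: (@le_trans _ _ (expR (4 + ln D))).
  rewrite expRD lnK ?posrE //; have := ler_wpM2r (ltW D0) (expR_ge1Dx (4 : R)).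
  lra.
rewrite ler_expR.
have : 1 <= Num.max 1 (ln D) by rewrite le_max lexx.
have : ln D <= Num.max 1 (ln D) by rewrite le_max lexx orbT.
lra.
Qed.

Theorem theorem3p1 (R : realType) :
  exists2 K : R, 0 < K &
    forall (n T : nat) (eps : R) (w : 'rV[R]_n) (C : {set 'I_T})
      (c p : 'I_T -> 'rV[R]_n) (x : 'I_T.+1 -> 'rV[R]_n),
      0 < eps -> eps <= 1 ->
      nonneg w ->
      (forall t, t \in C -> nonneg (c t)) ->
      (forall t, t \notin C -> nonneg (p t)) ->
      is_run eps w C c p x ->
      ((upward_recourse w x)%:E <=
         (K * competitive_rate eps (max_sparsity C c) (aspect_ratio C c))%:E *
         dual_opt w C c p)%E.
Proof.
exists 20 => // n T eps w C c p x eps0 eps1 w0 c0 p0 run.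
have xk := run_nonneg run.
have [m mE] := run_multipliers eps0 w0 c0 p0 run.
have m0 t : 0 <= m t by have := mE t; case: ifP => _ [].
have mC t : t \in C ->
    covering_multiplier eps w (c t) (x (before t)) (x (after t)) (m t).
  by move=> tC; have := mE t; rewrite tC.
have mP t : t \notin C ->
    packing_multiplier eps w (p t) (x (before t)) (x (after t)) (m t).
  by move=> tC; have := mE t; rewrite (negbTE tC).
set d := max_sparsity C c; set Delta := aspect_ratio C c.
pose D := d%:R * Delta / eps.
pose mx := Num.max 1 (ln D); pose L := 5 * mx.
have mx0 : 0 < mx by exact: rate_max_gt0.
have L0 : 0 < L by rewrite mulr_gt0.
(* Maximal sparsity and maximal coefficient make [delta i] a lower bound of every shift of
   coordinate [i]. *)
pose delta i := eps / (4 * d%:R * coef_max C c i).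
pose M i := (coef_min C c i)^-1 + delta i.
have dp i : 0 < coef_max C c i -> (0 : R) < d%:R.
  by move=> ci; rewrite ltr0n (max_sparsity_gt0 ci).
have delta0 i : 0 < coef_max C c i -> 0 < delta i.
  by move=> ci; rewrite divr_gt0 // !mulr_gt0 // (dp i).
have cmin0 i : 0 < coef_max C c i -> 0 < coef_min C c i by move=> ci; exact: coef_min_gt0.
have M0 i : 0 < coef_max C c i -> 0 < M i.
  by move=> ci; rewrite addr_gt0 ?delta0 // invr_gt0 cmin0.
have cmax_gt0 t i : t \in C -> c t 0 i != 0 -> 0 < coef_max C c i.
  move=> tC ci; apply: lt_le_trans (coef_max_ge c i tC).
  by rewrite lt_neqAle eq_sym ci c0.
have delta_le t i : t \in C -> c t 0 i != 0 -> delta i <= Defs.shift eps (c t) i.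
  move=> tC ci; have cmax := cmax_gt0 t i tC ci.
  have ct0 : 0 < c t 0 i by rewrite lt_neqAle eq_sym ci c0.
  have rs0 : (0 : R) < (row_sparsity (c t))%:R by rewrite ltr0n (row_sparsity_gt0 ci).
  rewrite /delta /Defs.shift ler_pM2l // lef_pV2 ?posrE ?mulr_gt0 ?(dp i) //.
  rewrite ler_pM ?mulr_ge0 ?ler0n ?(ltW ct0) ?coef_max_ge //.
  by rewrite ler_pM2l // ler_nat row_sparsity_le_max.
(* Only covering steps raise a coordinate, and one that does ends with [c t 0 i * x <= 1]. *)
have x_le k i : 0 < w 0 i -> 0 < coef_max C c i -> x k 0 i <= (coef_min C c i)^-1.
  move=> wi ci; move: k; apply: run_ind => [|t IH].
    by have [-> _] := run; rewrite mxE invr_ge0 ltW // cmin0.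
  have [tC|tC] := boolP (t \in C); last first.
    by have [_ le_x _ _] := mP t tC; exact: le_trans (le_x i wi) IH.
  have [_ _ /(_ i wi)[_ [le_x|[cti le1]]] _ _] := mC t tC.
    exact: le_trans le_x IH.
  rewrite -[leRHS]mul1r ler_pdivlMr ?cmin0 // mulrC.
  by apply: le_trans le1; rewrite ler_wpM2r ?xk // coef_min_le.
have M_ratio i : 0 < coef_max C c i -> M i / delta i <= expR L.
  move=> ci.
  have De : d%:R * (coef_max C c i / coef_min C c i) / eps <= D.
    by rewrite /D ler_pM2r ?invr_gt0 // ler_pM2l ?(dp i) // aspect_ratio_ge.
  have De1 : 1 <= d%:R * (coef_max C c i / coef_min C c i) / eps.
    rewrite ler_pdivlMr // mul1r; apply: le_trans eps1 _.
    rewrite -[leLHS]mulr1 ler_pM //; first by rewrite ler1n (max_sparsity_gt0 ci).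
    by rewrite ler_pdivlMr ?cmin0 // mul1r coef_min_le_max.
  apply: le_trans (ratio_le_expR (le_trans De1 De)).
  apply: (@le_trans _ _ (1 + 4 * (d%:R * (coef_max C c i / coef_min C c i) / eps))).
    rewrite le_eqVlt; apply/orP; left; apply/eqP; rewrite /M /delta; field.
    by rewrite !gt_eqF ?cmin0 ?(dp i).
  by rewrite lerD2l ler_pM2l.
(* Where [coef_max] is [0], [delta i] is [0] too and the logarithm is meaningless; [r] is set to [0]
   there. *)
pose pot k i := if 0 < coef_max C c i
  then potential (M i) (delta i) (w 0 i) (x k 0 i) else 0.
have pot_bounds k i : 0 <= pot k i <= w 0 i * L.
  rewrite /pot; case: ifP => [ci|_]; last by rewrite lexx mulr_ge0 // ltW.
  have [wi|wi] := ltP 0 (w 0 i); last first.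
    have -> : w 0 i = 0 by apply/le_anti; rewrite wi w0.
    by rewrite /potential !mul0r lexx.
  apply: potential_bounds; rewrite ?delta0 ?M_ratio ?w0 ?xk //.
  by rewrite lerD2r x_le.
have pot0 a b u i : w 0 i <= 0 -> potential a b (w 0 i) u = 0.
  by move=> wi; have -> : w 0 i = 0; [apply/le_anti; rewrite wi w0 | exact: mul0r].
pose Y := \sum_(t in C) m t; pose Z := \sum_(t < T | t \notin C) m t.
have Y0 : 0 <= Y by apply: sumr_ge0.
have feas : dual_feasible w C c p (fun t => m t / L) (fun t => m t / L)
    (fun k => \row_i (pot k i / L)).
  split.
  - by move=> t; rewrite divr_ge0 // ltW.
  - by move=> t; rewrite divr_ge0 // ltW.
  - move=> t i tC; rewrite !mxE mulrA -mulrBl -mulrDl pmulr_lle0 ?invr_gt0 //.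
    suff : m t * c t 0 i <= pot (before t) i - pot (after t) i by lra.
    have [_ pos _ drop _] := mC t tC.
    have [cti|cti] := eqVneq (c t 0 i) 0.
      rewrite cti mulr0 /pot; case: ifP => ci; last by rewrite subrr.
      have [wi|wi] := ltP 0 (w 0 i); last by rewrite !pot0 // subrr.
      apply: potential_drop; rewrite ?xk ?M0 ?delta0 //.
      have := drop i (delta i) wi; rewrite cti mulr0; apply.
      by rewrite eqxx.
    have ci := cmax_gt0 t i tC cti; rewrite /pot ci.
    have [wi|wi] := ltP 0 (w 0 i).
      apply: potential_drop; rewrite ?xk ?M0 ?delta0 //.
      by apply: drop => // _; exact: delta_le.
    rewrite !pot0 // subrr.
    (* Zero weight forces [r = 0]; the constraint survives because the multiplier vanishes. *)
    have [/pos/(_ i cti)|mt] := ltP 0 (m t); first by rewrite ltNge wi.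
    by have -> : m t = 0; [apply/le_anti; rewrite mt m0 | rewrite mul0r].
  - move=> t i tC; rewrite !mxE mulrA -mulrBl -mulrDl pmulr_lle0 ?invr_gt0 //.
    suff : - m t * p t 0 i <= pot (before t) i - pot (after t) i by lra.
    have [_ _ drop _] := mP t tC.
    have mp : - m t * p t 0 i <= 0 by rewrite mulNr oppr_le0 mulr_ge0 ?p0.
    rewrite /pot; case: ifP => ci; last by rewrite subrr.
    have [wi|wi] := ltP 0 (w 0 i); last by rewrite !pot0 // subrr.
    apply: potential_drop; rewrite ?xk ?M0 ?delta0 //.
    by apply: drop => //; rewrite ltW ?delta0.
  - move=> k i; rewrite mxE; have /andP[b1 b2] := pot_bounds k i.
    by rewrite divr_ge0 ?(ltW L0) //= ler_pdivrMr.
have recourse_le : upward_recourse w x <= (1 + eps / 4) * Y.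
  rewrite /upward_recourse (bigID (mem C)) /= /Y mulr_sumr -[leRHS]addr0.
  apply: lerD; first apply: ler_sum => t tC.
    have [_ _ mono _ le_m] := mC t tC; apply: le_trans le_m.
    apply: ler_sum => i _; have [wi|wi] := ltP 0 (w 0 i); last first.
      by have -> : w 0 i = 0; [apply/le_anti; rewrite wi w0 | rewrite !mul0r].
    by rewrite /pos_part max_r // subr_ge0; have [] := mono i wi.
  apply: sumr_le0 => t tC; apply: sumr_le0 => i _.
  have [_ mono _ _] := mP t tC; have [wi|wi] := ltP 0 (w 0 i); last first.
    by have -> : w 0 i = 0; [apply/le_anti; rewrite wi w0 | rewrite mul0r].
  by rewrite /pos_part max_l ?mulr0 // subr_le0 mono.
have balance : (1 + eps) * Z <= (1 + eps / 4) * Y.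
  rewrite -subr_ge0.
  apply: (@le_trans _ _ (\sum_(t < T) \sum_i
      w 0 i * (x (after t) 0 i - x (before t) 0 i))).
    (* Per coordinate the moves telescope to the final value, as the run starts at [0]. *)
    rewrite exchange_big /=; apply: sumr_ge0 => i _.
    rewrite -mulr_sumr mulr_ge0 // (telescope_run (fun k => x k 0 i)).
    by have [-> _] := run; rewrite mxE subr0 xk.
  rewrite (bigID (mem C)) /= /Y /Z !mulr_sumr -sumrN.
  apply: lerD; apply: ler_sum => t tC.
    by have [] := mC t tC.
  by have [] := mP t tC.
apply: (@le_trans _ _ ((20 * competitive_rate eps d Delta) * ((Y - Z) / L))%:E).
  rewrite lee_fin; apply: le_trans recourse_le _.
  have -> : 20 * competitive_rate eps d Delta * ((Y - Z) / L) = 4 * (Y - Z) / eps.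
    rewrite /competitive_rate -/D -/mx /L; field.
    by rewrite !gt_eqF.
  rewrite ler_pdivlMr // -(@ler_pM2l _ (1 + eps)); last lra.
  (* [balance] gives [4 * (1 + eps) * (Y - Z) >= 3 * eps * Y], and
     [(1 + eps) * (1 + eps / 4) <= 5 / 2] for [eps <= 1]. The constant [20] is this [4] times the
     [5] in [L]. *)
  have e2 : (1 + eps) * ((1 + eps / 4) * eps) <= 3 * eps by nra.
  have := ler_wpM2r Y0 e2; lra.
rewrite EFinM lee_pmul2l //; last first.
  by rewrite lte_fin mulr_gt0 // mulr_gt0 ?invr_gt0 // rate_max_gt0.
apply: ereal_sup_ubound; exists (fun t => m t / L), (fun t => m t / L),
  (fun k => \row_i (pot k i / L)); split=> //.
by rewrite /dual_objective -!mulr_suml -mulrBl.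
Qed.
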